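(* Let $A_n(x)=x^n+a_1x^{n-1}+\dots+a_n$ be a polynomial all of whose roots are real, with pairwise distinct roots $x_1,\dots,x_m$ of multiplicities $\alpha_1,\dots,\alpha_m$ respectively ($\alpha_1+\dots+\alpha_m=n$). Let $d=\min_{i\neq j}|x_i-x_j|$, and let $q,c$ be real numbers such that $0<q<1$, $c>0$, $d-2c>0$, and $$c^2(n-\alpha_i)<(\alpha_i d-2nc)(d-2c),\qquad i=1,\dots,m.$$ Suppose the initial approximations $x_i^{[0]}$ to the roots $x_i$ satisfy $|x_i^{[0]}-x_i|\le cq$ for $i=1,\dots,m$, and let $x_i^{[k]}$ be defined by the iteration $$x_i^{[k+1]}=x_i^{[k]}-\alpha_i\frac{A_n(x_i^{[k]})}{A_n'(x_i^{[k]})}\left[1+\frac{A_n(x_i^{[k]})}{A_n'(x_i^{[k]})}\cdot\frac{(Q_i^{[k]})'(x_i^{[k]})}{Q_i^{[k]}(x_i^{[k]})}\right],\quad i=1,\dots,m,\ k=0,1,\dots,$$ where $Q_i^{[k]}(x)=\prod_{j=1,\,j\neq i}^m\left(x-x_j^{[k]}\right)^{\alpha_j}$. Then for every positive integer $k$, $$|x_i^{[k]}-x_i|\le c\,q^{3^k},\qquad i=1,\dots,m.$$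
   Context: All numbers are real. The multiplicities $\alpha_i$ are positive integers known in advance. Primes denote derivatives with respect to $x$; in $(Q_i^{[k]})'$ the points $x_j^{[k]}$ are held fixed. The exponent $3^k$ in $q^{3^k}$ is the $k$-th power of $3$. *)

(* Defs.v *)
From mathcomp Require Import all_boot all_order all_algebra.
From mathcomp Require Import reals.

Set Implicit Arguments.
Unset Strict Implicit.
Unset Printing Implicit Defensive.

Import Order.TTheory GRing.Theory Num.Theory.
Local Open Scope ring_scope.

(* The sum of the [alpha i] being the degree of [A], [A] splits over [R] (all
   its roots are real) and the [x i] are all its roots. *)
Definition real_rooted (R : realType) (n m : nat) (A : {poly R})
    (x : 'I_m -> R) (alpha : 'I_m -> nat) : Prop :=
  [/\ A \is monic /\ size A = n.+1,
      injective x,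
      (forall i, (0 < alpha i)%N /\ mup (x i) A = alpha i)
    & (\sum_(i < m) alpha i = n)%N].

(* A minimum is attained, so this forces [2 <= m]. *)
Definition min_root_distance (R : realType) (m : nat) (x : 'I_m -> R)
    (d : R) : Prop :=
  (exists i j, i != j /\ d = `|x i - x j|) /\
  (forall i j, i != j -> d <= `|x i - x j|).

Definition Qpoly (R : realType) (m : nat) (alpha : 'I_m -> nat)
    (y : 'I_m -> R) (i : 'I_m) : {poly R} :=
  \prod_(j < m | j != i) ('X - (y j)%:P) ^+ alpha j.

(* If [y i] is a root of [A], then [A.[y i] / A^`().[y i] = 0], also when the
   root is multiple (here [0 / 0 = 0]): this is the limit of [A / A'] there, and
   the iteration stays at a root that it has reached. *)
Definition iter_step (R : realType) (m : nat) (A : {poly R})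
    (alpha : 'I_m -> nat) (y : 'I_m -> R) (i : 'I_m) : R :=
  let Q := Qpoly alpha y i in
  y i - (alpha i)%:R * (A.[y i] / A^`().[y i]) *
    (1 + A.[y i] / A^`().[y i] * (Q^`().[y i] / Q.[y i])).

(* Main.v *)
Require Import Defs.
From mathcomp Require Import all_boot all_order all_algebra.
From mathcomp Require Import reals.
From mathcomp Require Import ring lra.

Set Implicit Arguments.
Unset Strict Implicit.
Unset Printing Implicit Defensive.

Import Order.TTheory GRing.Theory Num.Theory.
Local Open Scope ring_scope.

(** Fix a root [x i] of multiplicity [a], let [N] be the sum of the other
    multiplicities, and let [y] be the current approximations, with error
    [e = y i - x i].  Logarithmic differentiation of the factored forms gives
    [A' / A = a / e + S] and [Q' / Q = T] at [y i], where
    [S = \sum_(j != i) alpha j / (y i - x j)] and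
    [T = \sum_(j != i) alpha j / (y i - y j)]: thus [Q' / Q] approximates the
    part of [A' / A] that comes from the other roots.  Substituting, the error
    after one step is exactly
      [e ^+ 2 * (a * (S - T) + e * S ^+ 2) / (a + e * S) ^+ 2]
    ([step_error_identity]).  The bracket is itself of first order, since
    [S - T] is a combination of the errors [y j - x j]; so the step is cubic.

    If all errors are at most [c * t] with [t <= 1], the distances [y i - x j]
    and [y i - y j] are at least [d - c] and [d - 2 * c], which bounds [S],
    [S - T] and [a + e * S], and the new error is at most
    [K * (c * t) ^+ 3] for an explicit [K].  The hypothesis relating [c], [d]
    and the multiplicities yields [K <= c ^- 2] ([contraction_constant]), so
    the new error is at most [c * t ^+ 3] ([step_error_bound],
    [iter_step_error]).  Starting from [t = q] and iterating, [t] becomes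
    [q ^+ (3 ^ k)] after [k] steps. *)

(** * Factorization and logarithmic derivatives *)

Lemma prod_coprimep_dvdp (F : fieldType) (I : eqType) (r : seq I)
    (P : I -> {poly F}) (p : {poly F}) :
  uniq r -> (forall i j, i != j -> coprimep (P i) (P j)) ->
  (forall i, P i %| p) -> \prod_(i <- r) P i %| p.
Proof.
move=> + coP divP; elim: r => [|i r IHr] /=; first by rewrite big_nil dvd1p.
case/andP=> ir ur; rewrite big_cons Gauss_dvdp ?divP ?IHr //.
elim: r ir {IHr ur} => [|j r IHr]; first by rewrite big_nil coprimep1.
rewrite inE negb_or big_cons coprimepMr => /andP[ij ir].
by rewrite coP //= IHr.
Qed.

(** The powers of distinct linear factors are coprime, so their product divides
    [p]; having the same degree and both being monic, the two are equal. *)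
Lemma monic_prod_XsubC_mup (F : fieldType) (I : finType) (p : {poly F})
    (x : I -> F) (a : I -> nat) :
  p \is monic -> size p = (\sum_i a i).+1 -> injective x ->
  (forall i, mup (x i) p = a i) ->
  p = \prod_i ('X - (x i)%:P) ^+ a i.
Proof.
move=> mp sp injx mup_p; set q := \prod_i _.
have mq : q \is monic by apply: monic_prod => i _; exact/monic_exp/monicXsubC.
have dq : q %| p.
  apply: prod_coprimep_dvdp; first exact: index_enum_uniq.
    move=> i j ij; apply/coprimep_expl/coprimep_expr/coprimep_XsubC2.
    by rewrite subr_eq0 eq_sym (inj_eq injx).
  by move=> i; rewrite -mup_geq ?monic_neq0 // mup_p.
have sq : size q = (\sum_i a i).+1.
  rewrite /q size_prod; last by move=> i _; rewrite expf_neq0 // polyXsubC_eq0.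
  rewrite (eq_bigr (fun i => (a i + 1)%N)); last first.
    by move=> i _; rewrite size_exp_XsubC addn1.
  by rewrite big_split /= sum1_card -addSn addnK.
by apply/eqP; rewrite eq_sym -eqp_monic // -dvdp_size_eqp // sp sq.
Qed.

Lemma logderiv_prod_XsubC_exp (F : fieldType) (I : finType) (P : pred I)
    (z : I -> F) (a : I -> nat) (y : F) :
  (forall j, P j -> y != z j) ->
  let p := \prod_(j | P j) ('X - (z j)%:P) ^+ a j in
  p^`().[y] / p.[y] = \sum_(j | P j) (a j)%:R * (y - z j)^-1.
Proof.
move=> yz p.
(* The induction is on [p'.[y] = p.[y] * sum]: stated without the quotient, it
   passes through the product rule. *)
suff: p.[y] != 0 /\ p^`().[y] = p.[y] * \sum_(j | P j) (a j)%:R * (y - z j)^-1.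
  by case=> py ->; rewrite mulrAC divff // mul1r.
rewrite /p; elim/big_rec2: _ => [|j s q Pj [qy IHq]].
  by rewrite hornerC oner_neq0 derivC horner0 mulr0.
have yzj : y - z j != 0 by rewrite subr_eq0 yz.
rewrite derivM deriv_exp derivXsubC mul1r hornerD !hornerM IHq hornerMn.
rewrite !horner_exp hornerXsubC mulf_neq0 ?expf_neq0 //; split=> //.
(* The exponent [(a j).-1] of the derivative forces the case [a j = 0] to be
   treated apart. *)
case: (a j) => [|k] /=; first by rewrite !mulr0n; ring.
by rewrite exprS -mulr_natr; field.
Qed.

(** * One step of the iteration *)

Lemma ler_norm_wsum (R : numDomainType) (I : finType) (P : pred I)
    (w : I -> nat) (f : I -> R) (B : R) :
  (forall j, P j -> `|f j| <= B) ->
  `|\sum_(j | P j) (w j)%:R * f j| <= (\sum_(j | P j) w j)%:R * B.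
Proof.
move=> fB; rewrite natr_sum mulr_suml (le_trans (ler_norm_sum _ _ _)) //.
by apply: ler_sum => j Pj; rewrite normrM normr_nat ler_wpM2l ?fB.
Qed.

(** Here [e / (a + e * S)] is [A / A'] and [T] is [Q' / Q].  The terms of first
    order in [e] cancel, and replacing [T] by [S] would leave [e ^+ 3] times a
    bounded quantity. *)
Lemma step_error_identity (F : fieldType) (a e S T : F) :
  a + e * S != 0 ->
  e - a * (e / (a + e * S)) * (1 + e / (a + e * S) * T) =
  e ^+ 2 * (a * (S - T) + e * S ^+ 2) / (a + e * S) ^+ 2.
Proof. by move=> h; field. Qed.

(** The numerical heart of the argument, where [a + N] is the degree.  The first
    conclusion keeps [a + e * S] away from [0]; the second is [K <= c ^- 2],
    cleared of denominators, for the constant [K] of the cubic error bound.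
    Both come from writing [a * d - (a + N) * c = (a + N) * c + w], where
    [w] is the first factor on the right of the hypothesis and is positive.
    The hypothesis, read as [c ^+ 2 * N < w * (d - 2 * c)], is used once to
    bound the part of the left-hand side that remains when a multiple of
    [d - 2 * c] is split off; what is then left of the difference of the two
    sides, divided by [d - 2 * c], is a polynomial in [w] with nonnegative
    coefficients. *)
Lemma contraction_constant (R : realFieldType) (a N d c : R) :
  0 < a -> 0 <= N -> 0 < c -> 0 < d - 2 * c ->
  c ^+ 2 * N < (a * d - 2 * (a + N) * c) * (d - 2 * c) ->
  0 < a * d - (a + N) * c /\
  c ^+ 2 * N * (a * (d - c) + N * (d - 2 * c)) <=
    (a * d - (a + N) * c) ^+ 2 * (d - 2 * c).
Proof.
move=> a0 N0 c0; set r := d - 2 * c => r0 cond.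
set w := a * d - 2 * (a + N) * c in cond.
have w0 : 0 < w.
  by rewrite -(pmulr_lgt0 _ r0); apply: le_lt_trans cond;
    rewrite mulr_ge0 ?exprn_ge0 // ltW.
have nc0 : 0 < (a + N) * c by rewrite mulr_gt0 ?ltr_wpDr.
have uE : a * d - (a + N) * c = (a + N) * c + w by rewrite /w; ring.
rewrite uE; split; first by rewrite addr_gt0.
have -> : c ^+ 2 * N * (a * (d - c) + N * r) =
    (c ^+ 2 * N) * (a + N) * r + (c * a) * (c ^+ 2 * N).
  by rewrite /r; ring.
apply: (@le_trans _ _ ((c ^+ 2 * N) * (a + N) * r + (c * a) * (w * r))).
  by rewrite lerD2l ler_wpM2l ?mulr_ge0 ?ltW.
rewrite -subr_ge0.
have -> : ((a + N) * c + w) ^+ 2 * r -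
    (c ^+ 2 * N * (a + N) * r + c * a * (w * r)) =
  r * (w ^+ 2 + c * w * (a + 2 * N) + c ^+ 2 * a * (a + N)) by ring.
have [wge0 cge0 age0 rge0] : [/\ 0 <= w, 0 <= c, 0 <= a & 0 <= r].
  by split; exact: ltW.
by do ![rewrite mulr_ge0 // | rewrite addr_ge0 // | rewrite exprn_ge0 //].
Qed.

(** The bounds on [S] and [S - T] use [c * t <= c] in the denominators only, so
    that exactly the factor [t ^+ 3] is left in the bound on the error. *)
Lemma step_error_bound (R : realFieldType) (a N d c t e S T : R) :
  0 < a -> 0 <= N -> 0 < c -> 0 < d - 2 * c ->
  c ^+ 2 * N < (a * d - 2 * (a + N) * c) * (d - 2 * c) ->
  0 <= t -> t <= 1 -> `|e| <= c * t ->
  `|S| <= N / (d - c) ->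
  `|S - T| <= N * (c * t / ((d - c) * (d - 2 * c))) ->
  a + e * S != 0 /\
  `|e ^+ 2 * (a * (S - T) + e * S ^+ 2) / (a + e * S) ^+ 2| <= c * t ^+ 3.
Proof.
move=> a0 N0 c0 r0 cond t0 t1 eb Sb STb.
have [u0 key] := contraction_constant a0 N0 c0 r0 cond.
set p := d - c in Sb STb key *; set r := d - 2 * c in r0 STb key cond.
set u := a * d - _ in u0 key.
have p0 : 0 < p by rewrite /p; rewrite /r in r0; lra.
have ct0 : 0 <= c * t by rewrite mulr_ge0 // ltW.
have den : u / p <= `|a + e * S|.
  have -> : u / p = a - c * (N / p).
    by rewrite /u /p; field; rewrite -/p gt_eqF.
  (* The perturbation [e * S] takes away at most [c * N / (d - c)] from [a]. *)
  have eS : `|e * S| <= c * (N / p).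
    rewrite normrM ler_pM //; apply: le_trans eb _.
    by rewrite ler_piMr // ltW.
  have := ler_normB a (a + e * S).
  have -> : a - (a + e * S) = - (e * S) by ring.
  have := lerB_dist a (- (e * S)); rewrite opprK normrN gtr0_norm //.
  lra.
have up0 : 0 < u / p by rewrite divr_gt0.
have D0 : 0 < `|a + e * S| by apply: lt_le_trans den.
split; first by rewrite -normr_gt0.
rewrite normrM normfV !normrX ler_pdivrMr ?exprn_gt0 //.
have num : `|e ^+ 2 * (a * (S - T) + e * S ^+ 2)| <=
    (c * t) ^+ 2 * (a * (N * (c * t / (p * r))) + c * t * (N / p) ^+ 2).
  rewrite normrM normrX ler_pM ?exprn_ge0 ?lerXn2r ?nnegrE //.
  apply: le_trans (ler_normD _ _) _; rewrite lerD // normrM.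
    by rewrite gtr0_norm // ler_wpM2l // ltW.
  by rewrite normrX ler_pM ?exprn_ge0 // lerXn2r ?nnegrE // divr_ge0 // ltW.
apply: le_trans num _.
apply: (@le_trans _ _ (c * t ^+ 3 * (u / p) ^+ 2)); last first.
  by rewrite ler_wpM2l ?mulr_ge0 ?exprn_ge0 ?(ltW c0) // lerXn2r ?nnegrE // ltW.
(* Over the common denominator [p ^+ 2 * r], the two sides compare through the
   inequality [key]. *)
have -> : (c * t) ^+ 2 * (a * (N * (c * t / (p * r))) + c * t * (N / p) ^+ 2) =
    c * t ^+ 3 * ((c ^+ 2 * N * (a * p + N * r)) / (p ^+ 2 * r)).
  by field; rewrite !gt_eqF.
have -> : (u / p) ^+ 2 = u ^+ 2 * r / (p ^+ 2 * r).
  by field; rewrite !gt_eqF.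
rewrite ler_wpM2l ?mulr_ge0 ?exprn_ge0 ?(ltW c0) //.
by rewrite ler_wpM2r ?invr_ge0 ?mulr_ge0 ?exprn_ge0 // ltW.
Qed.

(** Both logarithmic derivatives are available because [y i] stays at distance at
    least [d - c] from the other roots and [d - 2 * c] from the other
    approximations.  In [S - T], each difference of inverses equals
    [(x j - y j) / ((y i - x j) * (y i - y j))], which is where the accuracy of
    the other approximations enters. *)
Lemma iter_step_error (R : realType) (m : nat) (x : 'I_m -> R)
    (alpha : 'I_m -> nat) (y : 'I_m -> R) (i : 'I_m) (d c t : R) :
  let N := (\sum_(j | j != i) alpha j)%N%:R in
  let a := (alpha i)%:R in
  (0 < alpha i)%N -> (forall j, j != i -> d <= `|x i - x j|) ->
  0 < c -> 0 < d - 2 * c ->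
  c ^+ 2 * N < (a * d - 2 * (a + N) * c) * (d - 2 * c) ->
  0 <= t -> t <= 1 -> (forall j, `|y j - x j| <= c * t) ->
  `|iter_step (\prod_j ('X - (x j)%:P) ^+ alpha j) alpha y i - x i|
     <= c * t ^+ 3.
Proof.
move=> N a ai0 dx c0 r0 cond t0 t1 yb.
have a0 : 0 < a by rewrite ltr0n.
have N0 : 0 <= N by rewrite ler0n.
have ct0 : 0 <= c * t by rewrite mulr_ge0 // ltW.
have ct_le : c * t <= c by rewrite ler_piMr // ltW.
have p0 : 0 < d - c by lra.
set A := \prod_j _; rewrite /iter_step.
set e := y i - x i; have eb : `|e| <= c * t := yb i.
(* At the root itself the logarithmic derivative of [A] is unavailable, but the
   step leaves [y i] in place since [A.[y i] = 0]. *)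
have [e0|e_neq0] := eqVneq e 0.
  have yx : y i = x i by apply/eqP; rewrite -subr_eq0 -/e e0.
  have A0 : A.[y i] = 0.
    rewrite /A (bigD1 i) //= hornerM horner_exp hornerXsubC -/e e0.
    by rewrite expr0n gtn_eqF // mul0r.
  rewrite A0 !mul0r mulr0 mul0r subr0 -/e e0 normr0.
  by rewrite mulr_ge0 ?exprn_ge0 // ltW.
have ux j : j != i -> d - c <= `|y i - x j|.
  move=> ji; have := dx j ji.
  have -> : x i - x j = (y i - x j) - e by rewrite /e; ring.
  by have := ler_normB (y i - x j) e; lra.
have uy j : j != i -> d - 2 * c <= `|y i - y j|.
  move=> ji; have := ux j ji.
  have -> : y i - x j = (y i - y j) + (y j - x j) by ring.
  by have := ler_normD (y i - y j) (y j - x j); have := yb j; lra.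
have ux_neq j : j != i -> y i - x j != 0.
  by move=> ji; rewrite -normr_gt0 (lt_le_trans p0) ?ux.
have uy_neq j : j != i -> y i - y j != 0.
  by move=> ji; rewrite -normr_gt0 (lt_le_trans r0) ?uy.
set S := \sum_(j | j != i) (alpha j)%:R * (y i - x j)^-1.
set T := \sum_(j | j != i) (alpha j)%:R * (y i - y j)^-1.
have Sb : `|S| <= N / (d - c).
  apply: ler_norm_wsum => j ji; rewrite normfV lef_pV2 ?posrE ?ux //.
  by rewrite normr_gt0 ux_neq.
have STb : `|S - T| <= N * (c * t / ((d - c) * (d - 2 * c))).
  have -> : S - T = \sum_(j | j != i)
      (alpha j)%:R * ((x j - y j) / ((y i - x j) * (y i - y j))).
    rewrite /S /T -sumrB; apply: eq_bigr => j ji.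
    by field; rewrite ux_neq ?uy_neq.
  apply: ler_norm_wsum => j ji; rewrite normrM normfV ler_pM ?invr_ge0 //.
    by rewrite distrC.
  rewrite lef_pV2 ?posrE ?normr_gt0 ?mulf_neq0 ?ux_neq ?uy_neq ?mulr_gt0 //.
  by rewrite normrM ler_pM ?ux ?uy // ltW.
have [aeS0 bound] := step_error_bound a0 N0 c0 r0 cond t0 t1 eb Sb STb.
have AE : A.[y i] / A^`().[y i] = e / (a + e * S).
  rewrite -invf_div logderiv_prod_XsubC_exp; last first.
    move=> j _; rewrite -subr_eq0; have [->//|] := eqVneq j i.
    exact: ux_neq.
  rewrite (bigD1 i) //= -/S -/e -/a; field.
  by rewrite e_neq0 aeS0.
have QE : (Qpoly alpha y i)^`().[y i] / (Qpoly alpha y i).[y i] = T.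
  rewrite /Qpoly logderiv_prod_XsubC_exp // => j ji.
  by rewrite -subr_eq0 uy_neq.
rewrite AE QE -addrAC -/e -/a; move: bound.
by rewrite -step_error_identity.
Qed.

(** * Cubic convergence *)

Theorem theorem1 (R : realType) (n m : nat) (A : {poly R})
    (x : 'I_m -> R) (alpha : 'I_m -> nat) (d q c : R)
    (xk : nat -> 'I_m -> R)
    (hA : real_rooted n A x alpha)
    (hd : min_root_distance x d)
    (hq0 : 0 < q) (hq1 : q < 1) (hc : 0 < c) (hdc : 0 < d - 2%:R * c)
    (hcond : forall i : 'I_m,
       c ^+ 2 * (n%:R - (alpha i)%:R) <
       ((alpha i)%:R * d - 2%:R * n%:R * c) * (d - 2%:R * c))
    (hinit : forall i : 'I_m, `|xk 0%N i - x i| <= c * q)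
    (hiter : forall (k : nat) (i : 'I_m),
       xk k.+1 i = iter_step A alpha (xk k) i) :
  forall k : nat, (0 < k)%N ->
  forall i : 'I_m, `|xk k i - x i| <= c * q ^+ (3 ^ k).
Proof.
have [[mA sA] injx /all_and2[apos mupA] sum_alpha] := hA.
have AE : A = \prod_j ('X - (x j)%:P) ^+ alpha j.
  by apply: monic_prod_XsubC_mup; rewrite // sum_alpha.
(* With [3 ^ 0 = 1], the bound on the starting values is the case [k = 0]. *)
have bound k i : `|xk k i - x i| <= c * q ^+ (3 ^ k).
  elim: k i => [|k IHk] i; first exact: hinit.
  have nE : n%:R = (alpha i)%:R + (\sum_(j | j != i) alpha j)%N%:R :> R.
    by rewrite -natrD -sum_alpha (bigD1 i).
  rewrite hiter AE expnSr exprM; apply: (@iter_step_error _ _ _ _ _ _ d) => //.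
  - by move=> j ji; apply: hd.2; rewrite eq_sym.
  - by have := hcond i; rewrite nE addrAC subrr add0r.
  - by rewrite exprn_ge0 // ltW.
  - by rewrite exprn_ile1 // ltW.
by move=> k _; exact: bound.
Qed.
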